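(* For every integer $r\ge1$, $$\frac{4^r}{\pi^r}=1+\sum_{n=1}^{\infty}\frac1{2^n}\sum_{j=1}^{n}\binom{r+j-1}{j}\sum_{\substack{n_1+\cdots+n_j=n\\ n_i\ge1}}\ \prod_{\ell=1}^{j}\left[\sum_{k=1}^{n_\ell}\frac{(-1)^{k+1}}{2k+1}\binom{n_\ell-1}{k-1}\right].$$ For every $n\ge1$, the coefficient of $2^{-n}$ (that is, the sum over $j$ from $1$ to $n$) is a positive rational number.
   Context: The sum over $n_1+\cdots+n_j=n$, $n_i\ge1$, is over ordered $j$-tuples of positive integers with sum $n$. *)

(* Defs.v *)
From mathcomp Require Import all_boot all_order all_algebra.
From mathcomp Require Import all_classical all_reals all_analysis.

Set Implicit Arguments.
Unset Strict Implicit.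
Unset Printing Implicit Defensive.

Import Order.TTheory GRing.Theory Num.Theory.
Local Open Scope ring_scope.

Definition part_weight (R : realType) (m : nat) : R :=
  \sum_(1 <= k < m.+1) (-1) ^+ k.+1 / (2 * k + 1)%:R * 'C(m - 1, k - 1)%:R.

(* Parts of a composition of [n] are at most [n], hence the codomain ['I_n.+1]. *)
Definition is_composition (n j : nat) (c : {ffun 'I_j -> 'I_n.+1}) : bool :=
  [forall l, (1 <= c l)%N] && ((\sum_(l < j) c l)%N == n).

Definition coefficient (R : realType) (r n : nat) : R :=
  \sum_(1 <= j < n.+1) 'C(r + j - 1, j)%:R *
    \sum_(c : {ffun 'I_j -> 'I_n.+1} | is_composition c)
      \prod_(l < j) part_weight R (c l).

(* Main.v *)
Require Import Defs.
From mathcomp Require Import all_boot all_order all_algebra.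
From mathcomp Require Import all_classical all_reals all_analysis.
From mathcomp Require Import ring lra.

Import Order.TTheory GRing.Theory Num.Theory.
Import numFieldNormedType.Exports.
Local Open Scope classical_set_scope.
Local Open Scope ring_scope.

(** Write w(m) for [part_weight R m].  Expanding (1 - x^2)^(m-1) shows that
    w(m) is the integral over [0, 1] of x^2 (1 - x^2)^(m-1).  Hence w(m) > 0,
    and summing a geometric series under the integral gives
      B := sum_(m >= 1) w(m) / 2^m = int_0^1 x^2 / (1 + x^2) dx = 1 - pi / 4.
    The bracket multiplying 2^-n in the theorem is the coefficient of X^n in
      sum_j C(r + j - 1, j) W(X)^j = (1 - W(X))^-r,  W(X) = sum_m w(m) X^m,
    so that the whole series is (1 - W(1/2))^-r = (1 - B)^-r = (4 / pi)^r.

    The integrals are replaced by explicit polynomial primitives and the mean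
    value theorem ([part_weight_gt0], [weight_series_cvg]).

    Negative binomial series of power series are avoided by an induction on r.
    Pascal's rule says that the coefficients u_r(n) of (1 - W)^-r satisfy
      u_(r+1)(n) = u_r(n) + sum_(i <= n) w(i) u_(r+1)(n - i),
    which is (1 - W) (1 - W)^-(r+1) = (1 - W)^-r read coefficientwise
    ([gen_coef_rec]); it is a polynomial identity truncated at degree n.  All
    terms being nonnegative, a renewal argument ([renewal_cvg]) shows that each
    step divides the sum of the series by 1 - B = pi / 4.  The same recurrence
    gives u_(r+1)(n) >= w(n) u_(r+1)(0) = w(n) > 0 for n >= 1, which is the
    positivity claim. *)

(** * Renewal equations with nonnegative terms *)

Lemma series_convolution {R : pzRingType} (b c : nat -> R) (N : nat) :
  \sum_(0 <= n < N) \sum_(i < n.+1) b i * c (n - i)%N =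
  \sum_(0 <= i < N) b i * \sum_(0 <= k < N - i) c k.
Proof.
elim: N => [|N IH]; first by rewrite !big_nil.
rewrite big_nat_recr //= IH [RHS]big_nat_recr //= subSn // subnn big_nat1.
rewrite big_ord_recr /= subnn addrA; congr (_ + _).
rewrite -(big_mkord xpredT (fun i => b i * c (N - i)%N)) -big_split /=.
apply: eq_big_nat => i /andP[_ ltiN].
by rewrite subSn ?(ltnW ltiN) // big_nat_recr //= mulrDr.
Qed.

Lemma series_ge0_homo {R : numDomainType} {u : nat -> R} : (forall n, 0 <= u n) ->
  {homo (fun N => \sum_(0 <= n < N) u n) : m n / (m <= n)%N >-> m <= n}.
Proof.
move=> u_ge0 m n lemn; rewrite [leRHS](big_cat_nat (n := m)) //= lerDl.
by apply: sumr_ge0.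
Qed.

Section Renewal.
Context {R : realType} {a b c : nat -> R}.
Context (a_ge0 : forall n, 0 <= a n) (b_ge0 : forall n, 0 <= b n).
Context (c_ge0 : forall n, 0 <= c n).
Context (renewal : forall n, c n = a n + \sum_(i < n.+1) b i * c (n - i)%N).

Lemma renewal_series (N : nat) : \sum_(0 <= n < N) c n =
  \sum_(0 <= n < N) a n + \sum_(0 <= i < N) b i * \sum_(0 <= k < N - i) c k.
Proof.
by rewrite -series_convolution -big_split; apply: eq_bigr => i _; exact: renewal.
Qed.

Lemma renewal_series_le (N : nat) : \sum_(0 <= n < N) c n <=
  \sum_(0 <= n < N) a n + (\sum_(0 <= n < N) b n) * \sum_(0 <= n < N) c n.
Proof.
rewrite [leLHS]renewal_series lerD2l mulr_suml; apply: ler_sum => i _.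
by apply: ler_wpM2l => //; apply: series_ge0_homo => //; exact: leq_subr.
Qed.

(** The square of indices below [N] is contained in the triangle of pairs with
    sum below [N * 2]; this is why the partial sum of double length appears. *)
Lemma renewal_series_ge (N : nat) :
  \sum_(0 <= n < N * 2) a n + (\sum_(0 <= n < N) b n) * \sum_(0 <= n < N) c n
  <= \sum_(0 <= n < N * 2) c n.
Proof.
rewrite [leRHS]renewal_series lerD2l mulr_suml.
rewrite [leRHS](big_cat_nat (n := N)) ?leq_pmulr //=.
rewrite -[leLHS]addr0; apply: lerD; last first.
  by apply: sumr_ge0 => i _; rewrite mulr_ge0 // sumr_ge0.
apply: ler_sum_nat => i /andP[_ ltiN]; apply: ler_wpM2l => //.
apply: series_ge0_homo => //.
by rewrite muln2 -addnn -addnBA ?leq_addr // ltnW.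
Qed.

(** The partial sums of [c] increase, and C_N <= A + B C_N with B < 1 bounds
    them; passing to the limit in [renewal_series_le] and [renewal_series_ge]
    gives C = A + B C. *)
Lemma renewal_cvg (A B : R) :
  (fun N => \sum_(0 <= n < N) a n) @ \oo --> A ->
  (fun N => \sum_(0 <= n < N) b n) @ \oo --> B -> B < 1 ->
  (fun N => \sum_(0 <= n < N) c n) @ \oo --> A / (1 - B).
Proof.
move=> cvA cvB ltB1.
have B1_gt0 : 0 < 1 - B by rewrite subr_gt0.
have le_lim (u : nat -> R) (U : R) : (forall n, 0 <= u n) ->
    (fun N => \sum_(0 <= n < N) u n) @ \oo --> U ->
    forall N, \sum_(0 <= n < N) u n <= U.
  move=> u_ge0 cvU N; rewrite -(cvg_lim _ cvU) //.
  apply: nondecreasing_cvgn_le; first exact: series_ge0_homo.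
  by apply/cvg_ex; exists U.
have Sc_ge0 N : 0 <= \sum_(0 <= n < N) c n by apply: sumr_ge0.
have bounded N : \sum_(0 <= n < N) c n <= A / (1 - B).
  rewrite ler_pdivlMr // mulrBr mulr1 lerBlDr [_ * B]mulrC.
  apply: le_trans (renewal_series_le N) _.
  by rewrite lerD ?ler_wpM2r ?le_lim.
have cvC : cvgn (fun N => \sum_(0 <= n < N) c n).
  apply: nondecreasing_is_cvgn; first exact: series_ge0_homo.
  by exists (A / (1 - B)) => _ [N _ <-].
have /cvg_ex[C cvC'] := cvC.
suff -> : A / (1 - B) = C by [].
have eqC : C = A + B * C.
  apply/eqP; rewrite eq_le; apply/andP; split.
    apply: (ler_cvg_to cvC' (cvgD cvA (cvgM cvB cvC'))).
    by apply: nearW => N; exact: renewal_series_le.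
  have cv2 (u : nat -> R) (U : R) : u @ \oo --> U ->
      (fun N => u (N * 2)%N) @ \oo --> U.
    by move=> cvu; apply: cvg_comp cvu; exact: cvg_mulnr.
  apply: (ler_cvg_to (cvgD (cv2 _ _ cvA) (cvgM cvB cvC')) (cv2 _ _ cvC')).
  by apply: nearW => N; exact: renewal_series_ge.
apply/(canLR (mulfK (lt0r_neq0 B1_gt0))).
by rewrite mulrBr mulr1 [C * B]mulrC {1}eqC addrK.
Qed.
End Renewal.

(** * The coefficients as those of a negative power *)

Lemma coef_exp_agree {R : nzRingType} {p q : {poly R}} {n : nat} :
  (forall i, (i <= n)%N -> p`_i = q`_i) ->
  forall j i, (i <= n)%N -> (p ^+ j)`_i = (q ^+ j)`_i.
Proof.
move=> eqpq; elim=> [|j IH] i lein; first by rewrite !expr0.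
rewrite !exprS !coefM; apply: eq_bigr => k _.
rewrite eqpq ?IH //; first exact: leq_trans (leq_subr _ _) lein.
by apply: leq_trans lein; rewrite -ltnS.
Qed.

Lemma coef_exp_small {R : nzRingType} {p : {poly R}} : p`_0 = 0 ->
  forall j n, (n < j)%N -> (p ^+ j)`_n = 0.
Proof.
move=> p0; elim=> [|j IH] n //; rewrite ltnS => lenj.
rewrite exprS coefM big1 // => -[[|k] ltkn] _ /=; first by rewrite p0 mul0r.
rewrite IH ?mulr0 //; apply: leq_trans lenj.
by rewrite ltn_subrL /= (leq_trans _ (ltkn : (k < n)%N)).
Qed.

Section GeneratingPolynomial.
Context {R : realType}.

Definition weight_poly (N : nat) : {poly R} := \poly_(i < N.+1) part_weight R i.

Lemma part_weight0 : part_weight R 0 = 0.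
Proof. by rewrite /part_weight big_geq. Qed.

Lemma weight_poly0 N : (weight_poly N)`_0 = 0.
Proof. by rewrite coef_poly part_weight0. Qed.

(** Expanding the power as a product of sums ranges over all functions
    ['I_j -> 'I_n.+1]; those with a zero part contribute nothing because the
    weight of 0 is an empty sum. *)
Lemma composition_sumE (n j : nat) :
  \sum_(c : {ffun 'I_j -> 'I_n.+1} | is_composition c)
      \prod_(l < j) part_weight R (c l) = (weight_poly n ^+ j)`_n.
Proof.
rewrite -[in RHS](card_ord j) -prodr_const {1}/weight_poly poly_def.
rewrite (bigA_distr_bigA (fun (_ : 'I_j) (i : 'I_n.+1) => part_weight R i *: 'X^i)).
rewrite coef_sum big_mkcond /=; apply: eq_bigr => c _.
rewrite scaler_prod prodrXr coefZ coefXn /is_composition.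
case: (boolP [forall l, _]) => [_|].
  by rewrite eq_sym; case: eqP; rewrite ?mulr1 ?mulr0.
rewrite negb_forall => /existsP[l]; rewrite -leqNgt leqn0 => /eqP cl0.
by rewrite [X in X * _](bigD1 l) //= cl0 part_weight0 !mul0r.
Qed.

(** A truncation of (1 - W)^-r: its coefficients up to degree [N] are exact. *)
Definition gen_poly (r N : nat) : {poly R} :=
  \sum_(j < N.+1) 'C(r + j - 1, j)%:R *: weight_poly N ^+ j.

(** The value at [n = 0] is 1, the constant term of (1 - W)^-r, whereas the sum
    defining [coefficient R r 0] is empty. *)
Definition gen_coef (r n : nat) : R := (n == 0%N)%:R + coefficient R r n.

(** Coefficients of degree [n] depend neither on the weights of parts larger
    than [n] nor on powers with exponent larger than [n], as [weight_poly] has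
    no constant term. *)
Lemma coef_gen_poly (r N n : nat) : (n <= N)%N -> (gen_poly r N)`_n = gen_coef r n.
Proof.
move=> lenN; rewrite coef_sum.
under eq_bigr => j _.
  rewrite coefZ (coef_exp_agree (q := weight_poly n) (n := n)) //; last first.
    by move=> i lein; rewrite !coef_poly !ltnS lein (leq_trans lein).
  over.
rewrite -(big_mkord xpredT (fun j => 'C(r + j - 1, j)%:R * (weight_poly n ^+ j)`_n)).
rewrite (big_cat_nat (n := n.+1)) //= [X in _ + X]big_nat_cond.
rewrite [X in _ + X]big1 ?addr0; last first.
  by move=> j /andP[/andP[ltnj _] _]; rewrite coef_exp_small ?weight_poly0 ?mulr0.
rewrite big_nat_recl // expr0 coef1 bin0 mul1r; congr (_ + _).
rewrite /coefficient big_add1; apply: eq_bigr => j _.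
by rewrite composition_sumE.
Qed.

(** Pascal's rule, summed over [j]: the truncated form of the identity
    (1 - W)^-(r+1) = (1 - W)^-r + W (1 - W)^-(r+1). *)
Lemma gen_poly_rec (r N : nat) : gen_poly r.+1 N =
  gen_poly r N + weight_poly N * gen_poly r.+1 N
    - 'C(r + N, N)%:R *: weight_poly N ^+ N.+1.
Proof.
rewrite /gen_poly; set P := weight_poly N.
have binE j : 'C(r.+1 + j - 1, j) = 'C(r + j, j) by rewrite addSn subn1.
rewrite [X in P * X]big_ord_recr /= binE mulrDr -scalerAr -exprS addrA addrK.
rewrite mulr_sumr big_ord_recl [in RHS]big_ord_recl /= !bin0 -addrA; congr (_ + _).
rewrite -big_split; apply: eq_bigr => j _ /=.
rewrite -[bump 0 j]/j.+1 !binE -scalerAr -exprS addnS subn1.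
by rewrite binS natrD scalerDl.
Qed.

Lemma gen_coef_rec (r n : nat) : gen_coef r.+1 n =
  gen_coef r n + \sum_(i < n.+1) part_weight R i * gen_coef r.+1 (n - i).
Proof.
rewrite -!(@coef_gen_poly _ n) // {1}gen_poly_rec coefB coefD coefZ.
rewrite coef_exp_small ?weight_poly0 // mulr0 subr0 coefM; congr (_ + _).
by apply: eq_bigr => i _; rewrite coef_poly ltn_ord coef_gen_poly // leq_subr.
Qed.

End GeneratingPolynomial.

(** * The weights as integrals, and their sum *)

Section Weights.
Context {R : realType}.

(** The primitive of [x ^+ 2 * (1 - x ^+ 2) ^+ n] vanishing at 0. *)
Definition weight_primitive (n : nat) : {poly R} :=
  \sum_(i < n.+1) ((-1) ^+ i * 'C(n, i)%:R / (2 * i + 3)%:R) *: 'X^(2 * i + 3).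

Lemma weight_primitive0 n : (weight_primitive n).[0] = 0.
Proof.
by rewrite horner_sum big1 // => i _; rewrite !hornerE addnS expr0n mulr0.
Qed.

Lemma weight_primitive1 n : (weight_primitive n).[1] = part_weight R n.+1.
Proof.
rewrite horner_sum /part_weight big_add1 big_mkord; apply: eq_bigr => i _.
rewrite !hornerE expr1n mulr1 !subn1 /= !exprS mulrA mulrNN mul1r mul1r mulrAC.
by rewrite mulnS -addnA [(2 + _)%N]addnC -addnA.
Qed.

Lemma horner_deriv_weight_primitive n x :
  (weight_primitive n)^`().[x] = x ^+ 2 * (1 - x ^+ 2) ^+ n.
Proof.
rewrite exprBn mulr_sumr /weight_primitive raddf_sum horner_sum; apply: eq_bigr => i _.
rewrite /= derivZ derivXn !hornerE expr1n mulr1 hornerMn hornerXn -mulr_natr.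
rewrite addn3 /= exprS exprS exprM -[in RHS]mulr_natr.
have : (2 * i).+3%:R != 0 :> R by rewrite pnatr_eq0.
by move=> ?; field.
Qed.

(** A weight is the increment over [0, 1] of a polynomial with positive
    derivative inside the interval. *)
Lemma part_weight_gt0 n : 0 < part_weight R n.+1.
Proof.
have der (x : R) : x \in `]0, 1[ ->
    is_derive x 1 (horner (weight_primitive n)) (x ^+ 2 * (1 - x ^+ 2) ^+ n).
  by move=> _; rewrite -horner_deriv_weight_primitive; exact: is_derive_poly.
have cont : {within `[0, 1], continuous (horner (weight_primitive n))}.
  by apply: continuous_subspaceT => x; exact: continuous_horner.
have [c] := MVT ltr01 der cont.
rewrite in_itv /= weight_primitive0 weight_primitive1 !subr0 mulr1.
move=> /andP[c_gt0 ltc1] ->.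
by rewrite mulr_gt0 // exprn_gt0 // subr_gt0 expr_lt1 // ltW.
Qed.

Lemma part_weight_ge0 m : 0 <= part_weight R m.
Proof. by case: m => [|m]; rewrite ?part_weight0 ?(ltW (part_weight_gt0 _)). Qed.

(** The partial sum is the integral over [0, 1] of
    x^2 / (1 + x^2) (1 - y^N), where y = (1 - x^2) / 2 and
    1 - y = (1 + x^2) / 2.  The difference with 1 - pi / 4 is thus the increment
    over [0, 1] of a function whose derivative - x^2 / (1 + x^2) y^N is at most
    2^-N in absolute value; x - atan x is the primitive of x^2 / (1 + x^2). *)
Lemma weight_series_near (N : nat) :
  `|\sum_(0 <= n < N.+1) part_weight R n / 2 ^+ n - (1 - pi / 4)| <= 2^-1 ^+ N.
Proof.
pose P : {poly R} := \sum_(0 <= n < N) (2 ^- n.+1) *: weight_primitive n - 'X.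
pose f : R -> R := horner P + atan.
pose df (x : R) : R := - (x ^+ 2 / (1 + x ^+ 2)) * ((1 - x ^+ 2) / 2) ^+ N.
have sq_neq0 (x : R) : 1 + x ^+ 2 != 0 by rewrite gt_eqF // ltr_wpDr ?sqr_ge0.
have fdf (x : R) : is_derive x 1 f (df x).
  have -> : df x = P^`().[x] + (1 + x ^+ 2)^-1.
    rewrite /P derivB derivX hornerD hornerN hornerC raddf_sum horner_sum /df.
    elim: N {P f df} => [|N IH].
      by rewrite big_nil expr0; have := sq_neq0 x; move=> ?; field.
    rewrite big_nat_recr //= [_ + _ - 1]addrAC [_ + _ + (1 + _)^-1]addrAC -IH.
    rewrite derivZ hornerZ horner_deriv_weight_primitive !expr_div_n !(exprS _ N).
    have b_neq0 : 2 ^+ N != 0 :> R by rewrite expf_neq0.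
    have := sq_neq0 x; move: (_ ^+ N) (2 ^+ N) b_neq0 => a b ? ?; field.
    exact/andP.
  exact: is_deriveD.
have fcont : {within `[0, 1], continuous f}.
  apply: continuous_subspaceT => x; apply: differentiable_continuous.
  by apply/derivable1_diffP; have [] := fdf x.
have [c] := MVT ltr01 (fun x _ => fdf x) fcont.
rewrite in_itv /= => /andP[c_gt0 ltc1]; rewrite subr0 mulr1.
have f0 : f 0 = 0.
  rewrite /f fctE atan0 addr0 /P hornerD hornerN hornerX horner_sum.
  rewrite big1 ?subr0 // => i _.
  by rewrite hornerZ weight_primitive0 mulr0.
have f1 : f 1 = \sum_(0 <= n < N.+1) part_weight R n / 2 ^+ n - (1 - pi / 4).
  rewrite /f fctE atan1 /P hornerD hornerN hornerX horner_sum.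
  rewrite big_nat_recl // part_weight0 mul0r add0r opprB -addrA.
  rewrite [- 1 + _]addrC; congr (_ + _).
  by apply: eq_bigr => i _; rewrite hornerZ weight_primitive1 mulrC.
rewrite f0 subr0 f1 => ->.
rewrite /df normrM normrN -[leRHS]mul1r.
have c2 : 0 <= c ^+ 2 by exact: sqr_ge0.
have c2_le1 : c ^+ 2 <= 1 by rewrite expr_le1 // ltW.
apply: ler_pM => //.
  rewrite ger0_norm ?divr_ge0 ?addr_ge0 // ler_pdivrMr; lra.
by rewrite normrX lerXn2r ?nnegrE //; rewrite ger0_norm; lra.
Qed.

Lemma weight_series_cvg :
  (fun N => \sum_(0 <= n < N) part_weight R n / 2 ^+ n) @ \oo --> (1 - pi / 4 : R).
Proof.
rewrite -cvg_shiftS /=; apply/subr_cvg0; apply/norm_cvg0P.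
have h : (fun N => 2^-1 ^+ N : R) @ \oo --> (0 : R).
  by apply: cvg_expr; rewrite ger0_norm; lra.
apply: squeeze_cvgr (cvg_cst 0) h.
by apply: nearW => N; rewrite normr_ge0 weight_series_near.
Qed.

End Weights.

(** * Rationality, positivity and summation of the coefficients *)

Lemma part_weight_rat (R : realType) :
  exists w : nat -> rat, forall m, part_weight R m = ratr (w m).
Proof.
exists (fun m => \sum_(1 <= k < m.+1)
  (-1) ^+ k.+1 / (2 * k + 1)%:R * 'C(m - 1, k - 1)%:R) => m.
rewrite rmorph_sum; apply: eq_bigr => k _.
by rewrite /= !rmorphM rmorphXn fmorphV rmorphN1 !rmorph_nat.
Qed.

Lemma coefficient_rat (R : realType) (r n : nat) :
  exists q : rat, coefficient R r n = ratr q.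
Proof.
have [w wE] := part_weight_rat R.
exists (\sum_(1 <= j < n.+1) 'C(r + j - 1, j)%:R *
    \sum_(c : {ffun 'I_j -> 'I_n.+1} | is_composition c) \prod_(l < j) w (c l)).
rewrite rmorph_sum; apply: eq_bigr => j _ /=.
rewrite rmorphM rmorph_nat rmorph_sum; congr (_ * _).
by apply: eq_bigr => c _; rewrite rmorph_prod; apply: eq_bigr.
Qed.

Section Coefficients.
Context {R : realType}.

Lemma coefficient_ge0 (r n : nat) : 0 <= coefficient R r n.
Proof.
apply: sumr_ge0 => j _; rewrite mulr_ge0 ?ler0n // sumr_ge0 // => c _.
by rewrite prodr_ge0 // => l _; exact: part_weight_ge0.
Qed.

Lemma gen_coef_ge0 (r n : nat) : 0 <= gen_coef r n :> R.
Proof. by rewrite addr_ge0 ?ler0n ?coefficient_ge0. Qed.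

Lemma gen_coef_r0 (r : nat) : gen_coef r 0 = 1 :> R.
Proof. by rewrite /gen_coef /coefficient big_geq // addr0. Qed.

Lemma gen_coef_0n (n : nat) : gen_coef 0 n = (n == 0%N)%:R :> R.
Proof.
rewrite /gen_coef /coefficient big_nat_cond big1 ?addr0 // => j.
by rewrite andbT => /andP[j_gt0 _]; rewrite bin_small ?mul0r // add0n subn1 prednK.
Qed.

(** In the recurrence the last term alone, [part_weight R n.+1] times the
    constant coefficient 1, is already positive. *)
Lemma coefficient_gt0 (r n : nat) : 0 < coefficient R r.+1 n.+1.
Proof.
have -> : coefficient R r.+1 n.+1 = gen_coef r.+1 n.+1 by rewrite /gen_coef add0r.
rewrite gen_coef_rec big_ord_recr /= subnn gen_coef_r0 mulr1 addrA.
rewrite ltr_wpDl ?part_weight_gt0 // addr_ge0 ?gen_coef_ge0 // sumr_ge0 // => i _.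
by rewrite mulr_ge0 ?part_weight_ge0 ?gen_coef_ge0.
Qed.

(** Divided by [2 ^+ n], [gen_coef_rec] is a renewal equation whose kernel sums to
    1 - pi / 4, so each increment of [r] multiplies the sum by 4 / pi; for
    [r = 0] the series is the single term 1. *)
Lemma gen_coef_series_cvg (r : nat) :
  (fun N => \sum_(0 <= n < N) gen_coef r n / 2 ^+ n) @ \oo --> (4 ^+ r / pi ^+ r : R).
Proof.
elim: r => [|r IH].
  rewrite !expr0 divr1 -cvg_shiftS /=; apply: cvg_near_cst; apply: nearW => N.
  rewrite big_nat_recl // gen_coef_0n expr0 divr1 big1 ?addr0 // => n _.
  by rewrite gen_coef_0n mul0r.
have pi_gt0' := pi_gt0 R.
have -> : 4 ^+ r.+1 / pi ^+ r.+1 = 4 ^+ r / pi ^+ r / (1 - (1 - pi / 4)) :> R.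
  rewrite opprB addrC subrK !exprS invf_div invfM [LHS]mulrACA.
  by rewrite [LHS]mulrC.
apply: renewal_cvg IH weight_series_cvg _.
- by move=> n; rewrite divr_ge0 ?gen_coef_ge0 ?exprn_ge0.
- by move=> n; rewrite divr_ge0 ?part_weight_ge0 ?exprn_ge0.
- by move=> n; rewrite divr_ge0 ?gen_coef_ge0 ?exprn_ge0.
- move=> n; rewrite gen_coef_rec mulrDl mulr_suml; congr (_ + _).
  apply: eq_bigr => i _; rewrite mulrACA -invfM -exprD subnKC //.
  by rewrite -ltnS.
- by rewrite gtrBl divr_gt0.
Qed.

End Coefficients.

Theorem corollary6p3 (R : realType) (r : nat) (hr : (1 <= r)%N) :
  ((fun N : nat => 1 + \sum_(1 <= n < N.+1) 1 / 2 ^+ n * coefficient R r n)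
     @ \oo --> (4 ^+ r / pi ^+ r : R)) /\
  (forall n : nat, (1 <= n)%N ->
     exists2 q : rat, 0 < q & coefficient R r n = ratr q).
Proof.
split=> [|n n_ge1]; last first.
  have [q qE] := coefficient_rat R r n; exists q => //.
  rewrite -(ltr0q R) -qE -(prednK hr) -(prednK n_ge1); exact: coefficient_gt0.
rewrite [F in F @ _](_ : _ = fun N => \sum_(0 <= n < N.+1) gen_coef r n / 2 ^+ n).
  by have := @gen_coef_series_cvg R r; rewrite -cvg_shiftS.
apply/funext => N; rewrite [RHS]big_nat_recl // gen_coef_r0 expr0 divr1.
rewrite big_add1; congr (_ + _).
by apply: eq_bigr => n _; rewrite /gen_coef add0r div1r mulrC.
Qed.
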